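(* Let $A$ be an odd number and let $a_i$ denote the sequence of odd numbers in the Collatz sequence of $A$, with $a_0=A$. 1. Consider the sequence $c_i=4c_{i-1}+1$ with $c_0=A$. Then for any $i$, the Collatz sequences of $A$ and $c_i$ are equivalent. 2. For some $r\ge 0$, $a_r\equiv 1\bmod 4$, and $$a_i=\frac{3a_{i-1}+1}{2},\quad i=1,\dots,r,\qquad\text{and}\qquad a_{r+1}=\frac{3a_r+1}{2^k}\ \text{ for some } k\ge 2.$$ 3. If $A\equiv 1\bmod 4$ and $A>1$, then $A=2^k\times N+1$ for some odd number $N$ and $k\ge 2$. Let $n_i$ denote the odd numbers in the Collatz sequence of $N$, with $n_0=N$. (a) If $k=2$, then $a_1=n_1$. Moreover, if $A=4^dP+4^{d-1}+\cdots+4^2+4+1$ (with $d\ge 1$ and $P$ an integer) such that $P\not\equiv 1\bmod 4$, then $$a_1=\frac{3A+1}{4^d\times 2^i}=\frac{3P+1}{2^i},$$ where $i=1$ if $P$ is odd, and $i=0$ otherwise. (b) If $k>2$, write $k=2j+r$ with $r=0$ or $r=1$. If $r=0$, then $a_i=2^{k-2i}\times 3^iN+1$ for $i=1,\dots,j-1$, and the Collatz sequence of $A$ merges with the Collatz sequence of $3^{j-1}N$. On the other hand, if $r=1$, then $a_i=2^{k-2i}\times 3^iN+1$ for $i=1,\dots,j$.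
   Context: All starting numbers are positive integers. The Collatz sequence of a positive integer $A$ has first term $A$, and each term $x$ is followed by $3x+1$ if $x$ is odd and by $x/2$ if $x$ is even. The sequence of odd numbers in it consists of its odd terms in order, indexed from $0$; the odd term $1$ is followed by $1,1,1,\dots$. Two Collatz sequences (of odd starting numbers) are equivalent if the second odd number occurring in each sequence is the same, i.e. the odd terms with index $1$ coincide. Two Collatz sequences merge if they become equal after a finite number of terms of each, i.e. sequences $(x_i)$ and $(y_i)$ merge if there are $s,t\ge 0$ with $x_{s+i}=y_{t+i}$ for all $i\ge 0$. *)

(* Defs.v *)
From mathcomp Require Import all_boot.

Set Implicit Arguments.
Unset Strict Implicit.
Unset Printing Implicit Defensive.

Definition collatz_step (x : nat) : nat := if odd x then 3 * x + 1 else x./2.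

Definition collatz (A n : nat) : nat := iter n collatz_step A.

(* The term of index n is odd and exactly i odd terms come before it. *)
Definition odd_term_at (A i n : nat) : bool :=
  odd (collatz A n) && (count (fun m => odd (collatz A m)) (iota 0 n) == i).

Lemma collatzD A m n : collatz A (m + n) = collatz (collatz A m) n.
Proof. by rewrite /collatz addnC iterD. Qed.

Lemma collatz_gt0 A n : 0 < A -> 0 < collatz A n.
Proof.
move=> A_gt0; elim: n => //= n; rewrite /collatz_step.
case: ifP => [_ _|]; first by rewrite addn1.
by case: (collatz A n) => [|[|x]].
Qed.

Lemma collatz_odd_next A : 0 < A ->
  exists2 n, odd (collatz A n) & forall m, m < n -> ~~ odd (collatz A m).
Proof.
move=> A_gt0.
have [n odd_n min_n]: exists2 n, odd (collatz A n) &
    forall m, odd (collatz A m) -> n <= m.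
  suff ex_n: exists n, odd (collatz A n).
    by case: (ex_minnP ex_n) => n odd_n min_n; exists n.
  elim/ltn_ind: A A_gt0 => A IHA A_gt0.
  have [oddA|evenA] := boolP (odd A); first by exists 0.
  have [||n odd_n] := IHA A./2.
  - by rewrite ltn_half_double -addnn -{1}[A]addn0 ltn_add2l.
  - by case: A evenA A_gt0 {IHA} => [|[|A]].
  exists (1 + n); rewrite collatzD.
  by rewrite {2}/collatz /= /collatz_step (negPf evenA).
exists n => // m lt_mn; apply/negP => /min_n.
by rewrite leqNgt lt_mn.
Qed.

Lemma odd_term_at_ex A i : exists n, (A == 0) || odd_term_at A i n.
Proof.
case: (posnP A) => [->|A_gt0]; first by exists 0.
rewrite /odd_term_at; elim: i => [|i [n /andP[odd_n /eqP cnt_n]]].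
  have [n odd_n even_n] := collatz_odd_next A_gt0.
  exists n; rewrite odd_n /= eqn0Ngt -has_count; apply/hasPn => m.
  by rewrite mem_iota => /even_n.
have [m odd_m even_m] := collatz_odd_next (collatz_gt0 n.+1 A_gt0).
exists (n.+1 + m); rewrite collatzD odd_m iotaD count_cat -{1}addn1 iotaD.
rewrite count_cat /= cnt_n odd_n addn0 addn1 -[X in _ == X]addn0.
rewrite eqn_add2l eqn0Ngt -has_count; apply/hasPn => l.
rewrite mem_iota add0n => /andP[le_nl lt_l].
have := even_m (l - n.+1); rewrite -collatzD subnKC //; apply.
by rewrite ltn_subLR.
Qed.

(* The odd term of index i in the Collatz sequence of A; the value 0 for A = 0,
   whose sequence has no odd term, is a convention. *)
Definition odd_term (A i : nat) : nat := collatz A (ex_minn (odd_term_at_ex A i)).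

Definition collatz_equivalent (A B : nat) : Prop :=
  [/\ odd A, odd B & odd_term A 1 = odd_term B 1].

Definition collatz_merge (A B : nat) : Prop :=
  exists s t, forall i, collatz A (s + i) = collatz B (t + i).

(* Main.v *)
(**
  If [3 a_i + 1 = 2^k B] with [B] odd, then [a_(i+1) = B]; every claim reduces
  to exhibiting such a factorisation.  For part 2, write [A + 1 = 2^s m] with
  [m] odd: as long as [i < s], [a_i + 1 = 2^(s-i) 3^i m], so that [r = s - 1].
  For part 3(b), [3 (2^(k+2) M + 1) + 1 = 4 (2^k (3 M) + 1)].  For part 1 and
  part 3(a), [3 (4 M + 1) + 1 = 4 (3 M + 1)].
*)
Require Import Defs.
From mathcomp Require Import all_boot all_order all_algebra.
From mathcomp Require Import zify ring.

Set Implicit Arguments.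
Unset Strict Implicit.
Unset Printing Implicit Defensive.

Import GRing.Theory.

(** If [m < n], the terms before position [n] include the odd term at [m] and the [i] odd terms
    before it, which is one too many. Hence the position of an odd term is unique. *)
Lemma odd_term_at_leq A i n m :
  odd_term_at A i n -> odd_term_at A i m -> n <= m.
Proof.
move=> /andP[_ /eqP cnt_n] /andP[odd_m /eqP cnt_m].
rewrite leqNgt; apply/negP => lt_mn.
move: cnt_n; rewrite -(subnKC lt_mn) iotaD count_cat -addn1 iotaD count_cat.
rewrite cnt_m /= add0n odd_m; lia.
Qed.

Lemma odd_term_at_odd_term A i : 0 < A ->
  exists2 n, odd_term_at A i n & odd_term A i = collatz A n.
Proof.
move=> A_gt0; rewrite /odd_term; case: ex_minnP => n.
by rewrite eqn0Ngt A_gt0 /= => at_n _; exists n.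
Qed.

Lemma odd_termE A i n : 0 < A -> odd_term_at A i n -> odd_term A i = collatz A n.
Proof.
move=> A_gt0 at_n; have [m at_m ->] := odd_term_at_odd_term i A_gt0.
by congr collatz; apply/eqP; rewrite eqn_leq !(odd_term_at_leq (i := i) (A := A)).
Qed.

Lemma odd_term0 A : odd A -> odd_term A 0 = A.
Proof.
by move=> oddA; rewrite (@odd_termE A 0 0) ?odd_gt0 /odd_term_at //= oddA.
Qed.

Lemma collatz_odd a n : odd a -> collatz a n.+1 = collatz (3 * a + 1) n.
Proof. by move=> odd_a; rewrite /collatz iterSr {2}/collatz_step odd_a. Qed.

Lemma collatz_pow2M k l b : l <= k -> collatz (2 ^ k * b) l = 2 ^ (k - l) * b.
Proof.
elim: l => [|l IHl] lt_lk; first by rewrite subn0.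
rewrite -[l.+1]addn1 collatzD IHl 1?ltnW // /collatz /= /collatz_step.
have ->: k - l = (k - (l + 1)).+1 by lia.
by rewrite expnS -mulnA mul2n odd_double doubleK.
Qed.

(** After the odd term at position [n], the terms are [2 ^ (k - l) * b] for [l <= k]; these are even
    until [l = k], so [b] is the next odd term. *)
Lemma odd_termS A i k b : 0 < A -> odd b ->
  3 * odd_term A i + 1 = 2 ^ k * b -> odd_term A i.+1 = b.
Proof.
move=> A_gt0 odd_b; have [n /andP[odd_n /eqP cnt_n] ->] := odd_term_at_odd_term i A_gt0.
move=> def_b.
have collatz_n l : l <= k -> collatz A (n.+1 + l) = 2 ^ (k - l) * b.
  by move=> le_lk; rewrite addSnnS collatzD collatz_odd // def_b collatz_pow2M.
have collatz_k: collatz A (n.+1 + k) = b by rewrite collatz_n // subnn mul1n.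
rewrite -collatz_k; apply: odd_termE => //.
rewrite /odd_term_at collatz_k odd_b iotaD count_cat -{1}addn1 iotaD count_cat.
rewrite /= cnt_n odd_n addn0 addn1 -[X in _ == X]addn0 eqn_add2l eqn0Ngt.
rewrite -has_count; apply/hasPn => m; rewrite mem_iota => /andP[le_nm lt_mk].
rewrite -(subnKC le_nm) collatz_n; last by lia.
by rewrite oddM oddX; lia.
Qed.

Lemma odd_term1 A k b : odd A -> odd b -> 3 * A + 1 = 2 ^ k * b -> odd_term A 1 = b.
Proof.
by move=> oddA odd_b def_b; apply: (odd_termS (k := k)); rewrite ?odd_gt0 ?odd_term0.
Qed.

Lemma odd_part n : 0 < n -> exists k b, odd b /\ n = 2 ^ k * b.
Proof.
move=> n_gt0; have [b odd_b def_n] := pfactor_coprime (isT : prime 2) n_gt0.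
by exists (logn 2 n), b; rewrite -coprime2n mulnC.
Qed.

(** Both successors have the same odd part [b]: the factor 4 only raises the exponent of 2 from [k]
    to [k.+2]. *)
Lemma collatz_equivalent_4mul1 A : odd A -> collatz_equivalent A (4 * A + 1).
Proof.
move=> oddA; have [|k [b [odd_b def_b]]] := @odd_part (3 * A + 1); first by lia.
have odd4: odd (4 * A + 1) by lia.
split=> //; rewrite (odd_term1 oddA odd_b def_b).
by apply/esym/(@odd_term1 _ k.+2); rewrite // !expnS; lia.
Qed.

Lemma collatz_equivalent_trans A B C :
  collatz_equivalent A B -> collatz_equivalent B C -> collatz_equivalent A C.
Proof. by move=> [oddA _ eqAB] [_ oddC eqBC]; split; rewrite ?eqAB. Qed.

(** Quotients are taken in [rat], so that an equality also asserts divisibility. *)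
Lemma natr_div_pow2 a b k : a = 2 ^ k * b -> (b%:R = a%:R / 2 ^+ k :> rat)%R.
Proof.
move=> ->; rewrite natrM natrX mulrC mulKf //.
by rewrite expf_neq0.
Qed.

Lemma odd_term_add1 A s m i : odd A -> A + 1 = 2 ^ s * m -> i < s ->
  odd_term A i + 1 = 2 ^ (s - i) * 3 ^ i * m.
Proof.
move=> oddA def_m; elim: i => [|i IHi] lt_is.
  by rewrite odd_term0 // subn0 muln1.
have {}IHi := IHi (ltnW lt_is).
have def_si: s - i = (s - i.+2).+2 by lia.
have def_si1: s - i.+1 = (s - i.+2).+1 by lia.
have m_gt0: 0 < m by case: m def_m {IHi} => [|m]; lia.
have X_gt0: 0 < 2 ^ (s - i.+2) * (3 ^ i * m) by rewrite !muln_gt0 !expn_gt0 m_gt0.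
rewrite def_si !expnS in IHi; rewrite def_si1 !expnS.
(* With X the product bounded in [X_gt0], [a_i = 4X - 1] and [3 a_i + 1 = 2 (6X - 1)]: exactly one
   halving. Positivity of X keeps the natural subtraction exact. *)
rewrite (@odd_termS A i 1 (2 * 3 * (2 ^ (s - i.+2) * (3 ^ i * m)) - 1)).
- by lia.
- exact: odd_gt0.
- by lia.
- by lia.
Qed.

(** Each step trades a factor 4 for a factor 3. The bound [2 * i < k] leaves a positive power of 2,
    so the new term is odd. *)
Lemma odd_term_pow2M_add1 A k N i : A = 2 ^ k * N + 1 -> 2 * i < k ->
  odd_term A i = 2 ^ (k - 2 * i) * 3 ^ i * N + 1.
Proof.
move=> def_A; elim: i => [|i IHi] lt_ik.
  rewrite odd_term0 ?muln0 ?subn0 ?muln1 // def_A.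
  by rewrite oddD oddM oddX; lia.
have {}IHi: odd_term A i = _ := IHi ltac:(lia).
have def_ki: k - 2 * i = (k - 2 * i.+1).+2 by lia.
apply: (@odd_termS A i 2); first by rewrite def_A addn1.
- by rewrite oddD !oddM oddX; lia.
- rewrite IHi def_ki !expnS; lia.
Qed.

(** Both sequences reach [3 * M + 1]: from [4 * M + 1] by one odd step and two halvings, from [M] by
    one odd step. *)
Lemma collatz_merge_4mul1 M : odd M -> collatz_merge (4 * M + 1) M.
Proof.
move=> odd_M; exists (1 + 2), 1 => i.
have odd4: odd (4 * M + 1) by lia.
rewrite -addnA !add1n (collatz_odd _ odd4) (collatz_odd _ odd_M) collatzD.
have ->: 3 * (4 * M + 1) + 1 = 2 ^ 2 * (3 * M + 1) by lia.
by rewrite collatz_pow2M // mul1n.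
Qed.

Lemma collatz_merge_collatz A n B : collatz_merge (collatz A n) B -> collatz_merge A B.
Proof.
by move=> [s [t eq_st]]; exists (n + s), t => i; rewrite -addnA collatzD.
Qed.

Lemma sum_pow4 d : (3 * \sum_(0 <= m < d) 4 ^+ m + 1 = 4 ^+ d :> int)%R.
Proof.
elim: d => [|d IHd]; first by rewrite big_geq.
by rewrite big_nat_recr //= mulrDr addrAC IHd exprS; ring.
Qed.

Theorem proposition2p1 (A : nat) (hA : odd A) :
  (* 1 *)
  (forall c : nat -> nat, c 0 = A -> (forall i, c i.+1 = 4 * c i + 1) ->
     forall i, collatz_equivalent A (c i))
  /\
  (* 2 *)
  (exists r : nat,
     [/\ odd_term A r = 1 %[mod 4],
         forall i, 1 <= i <= r ->
           ((odd_term A i)%:R = (3 * odd_term A i.-1 + 1)%N%:R / 2 :> rat)%R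
       & exists2 k, 2 <= k &
           ((odd_term A r.+1)%:R
              = (3 * odd_term A r + 1)%N%:R / 2 ^+ k :> rat)%R])
  /\
  (* 3 *)
  (A = 1 %[mod 4] -> 1 < A ->
     (exists k N, [/\ odd N, 2 <= k & A = 2 ^ k * N + 1])
     /\
     forall k N, odd N -> 2 <= k -> A = 2 ^ k * N + 1 ->
       (* 3(a) *)
       ((k = 2 -> odd_term A 1 = odd_term N 1)
        /\
        (forall (d : nat) (P : int), 1 <= d ->
           (A%:Z = 4 ^+ d * P + \sum_(0 <= m < d) 4 ^+ m)%R ->
           ~ (P = 1 %[mod 4])%Z ->
           let i := if (2 %| P)%Z then 0 else 1 in
           ((odd_term A 1)%:R = (3 * A + 1)%N%:R / (4 ^+ d * 2 ^+ i) :> rat)%R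
           /\ ((3 * A + 1)%N%:R / (4 ^+ d * 2 ^+ i)
                 = (3 * P + 1)%:~R / 2 ^+ i :> rat)%R))
       /\
       (* 3(b) *)
       (2 < k -> forall j r, r = 0 \/ r = 1 -> k = 2 * j + r ->
          (r = 0 ->
             (forall i, 1 <= i <= j - 1 ->
                odd_term A i = 2 ^ (k - 2 * i) * 3 ^ i * N + 1)
             /\ collatz_merge A (3 ^ (j - 1) * N))
          /\
          (r = 1 ->
             forall i, 1 <= i <= j ->
               odd_term A i = 2 ^ (k - 2 * i) * 3 ^ i * N + 1))).
Proof.
have A_gt0 := odd_gt0 hA.
split=> [c c0 cS i|].
  elim: i => [|i IHi]; first by rewrite c0.
  apply: (collatz_equivalent_trans IHi); rewrite cS.
  by case: IHi => _ odd_c _; apply: collatz_equivalent_4mul1.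
split=> [|A1mod4 A_gt1].
  have [|s [m [odd_m def_m]]] := @odd_part (A + 1); first by lia.
  have s_gt0: 0 < s by case: s def_m => [|s] //; lia.
  have add1 := odd_term_add1 hA def_m.
  have odd_3m i : odd (3 ^ i * m) by rewrite oddM oddX odd_m orbT.
  (* At [r = s - 1] a single factor 2 remains, which gives [a_r = 1] modulo 4. *)
  have last1: odd_term A s.-1 + 1 = 2 * (3 ^ s.-1 * m).
    by rewrite add1 ?mulnA; [congr (_ * _ * _); rewrite (_ : s - _ = 1) //|]; lia.
  have odd_last := odd_3m s.-1.
  exists s.-1; split=> [|i /andP[i_gt0 le_is]|].
  - by lia.
  - case: i i_gt0 le_is => //= i _ le_is; rewrite -[X in (_ / X)%R]expr1.
    apply: natr_div_pow2.
    have := add1 i ltac:(lia); have := add1 i.+1 ltac:(lia).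
    have ->: s - i = (s - i.+1).+1 by lia.
    by rewrite !expnS; lia.
  (* Since 4 divides [3 a_r + 1], splitting the quotient by 4 makes the total exponent [k.+2] at
     least 2. *)
  - have [|k [b [odd_b def_b]]] := @odd_part ((3 * odd_term A s.-1 + 1) %/ 4).
      by lia.
    have def4: 3 * odd_term A s.-1 + 1 = 2 ^ k.+2 * b.
      by rewrite !expnS; lia.
    by exists k.+2; rewrite ?(odd_termS A_gt0 odd_b def4) //; apply: natr_div_pow2.
split.
  have [|k [N [odd_N def_N]]] := @odd_part (A.-1 %/ 4); first by lia.
  by exists k.+2, N; split; rewrite // !expnS; lia.
move=> k N odd_N k_ge2 def_A; split; first split.
- move=> k2; rewrite def_A k2.
  by have [_ _ ->] := collatz_equivalent_4mul1 odd_N.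
- move=> d P d_gt0 def_P Pn1 i.
  have def3A: (3 * A%:Z + 1 = 4 ^+ d * (3 * P + 1))%R.
    by rewrite def_P mulrDr -addrA sum_pow4; ring.
  (* [i] is the exact exponent of 2 in [3 * P + 1]: an odd [P] is 3 modulo 4, so [3 * P + 1] is 2
     modulo 4. *)
  have odd_i: exists2 b : nat, odd b & (3 * P + 1 = 2 ^+ i * b%:Z)%R.
    (* The sign follows from [def3A]; it makes the passage to [absz] lossless. *)
    have P_ge0: (0 <= 3 * P + 1)%R.
      have: (0 < 4 ^+ d :> int)%R by rewrite Num.Theory.exprn_gt0.
      by nia.
    rewrite /i; case: ifP => Peven; clear -P_ge0 Peven Pn1.
      by exists (absz (3 * P + 1)%R); lia.
    by exists (absz ((3 * P + 1)%R %/ 2)%Z); lia.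
  have [b odd_b def_b] := odd_i.
  have def_ab: 3 * A + 1 = 2 ^ (2 * d + i) * b.
    apply/eqP; rewrite -eqz_nat PoszD !PoszM def3A def_b; apply/eqP.
    by rewrite mulrA expnD expnM PoszM -!natz !natrX.
  have two_neq0 n : (2 ^+ n != 0 :> rat)%R by rewrite expf_neq0.
  have pow4: (4 ^+ d * 2 ^+ i = 2 ^+ (2 * d + i) :> rat)%R.
    by rewrite exprD exprM.
  rewrite pow4 (odd_term1 hA odd_b def_ab) -(natr_div_pow2 def_ab); split=> //.
  by rewrite def_b rmorphM rmorphXn /= mulrC mulKf.
- move=> k_gt2 j r r01 def_k; split=> r_eq.
    split=> [i le_ij|]; first by apply: odd_term_pow2M_add1 => //; lia.
    (* For [k = 2 * j], the odd term of index [j - 1] has exponent 2 left, so it is [4 * M + 1] with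
       [M = 3 ^ (j - 1) * N]. *)
    have [n _ def_n] := odd_term_at_odd_term (j - 1) A_gt0.
    apply: (@collatz_merge_collatz _ n); rewrite -def_n.
    rewrite (odd_term_pow2M_add1 def_A); last by lia.
    rewrite (_ : k - _ = 2); last by lia.
    rewrite -mulnA; apply: collatz_merge_4mul1.
    by rewrite oddM oddX odd_N orbT.
  by move=> i le_ij; apply: odd_term_pow2M_add1 => //; lia.
Qed.
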